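(* Let $m,d\geq 1$ be integers and let $f:[0,4]\to\mathbb{R}$ be continuous on $[0,4]$ and $(2m-1)$ times differentiable on $(0,4)$, with $f^{(2m-1)}$ concave on $(0,4)$. Let $\omega_N=\{\mathbf{x}_1,\ldots,\mathbf{x}_N\}\subset S^d$ be a strongly $m$-sharp configuration. Then the potential $$p_f(\mathbf{x},\omega_N)=\sum_{i=1}^N f(|\mathbf{x}-\mathbf{x}_i|^2),\qquad \mathbf{x}\in S^d,$$ attains its absolute maximum over $S^d$ at every point of $\omega_N$. If moreover $f^{(2m-1)}$ is strictly concave on $(0,4)$, then every point of $S^d$ at which $p_f(\cdot,\omega_N)$ attains its absolute maximum over $S^d$ belongs to $\omega_N$.
   Context: $S^d=\{\mathbf{x}\in\mathbb{R}^{d+1}:|\mathbf{x}|=1\}$, with $|\cdot|$ the Euclidean norm; $\sigma_d$ is the normalized (probability) surface area measure on $S^d$. A finite configuration $\omega_N=\{\mathbf{x}_1,\dots,\mathbf{x}_N\}\subset S^d$ is a spherical $n$-design if $\frac1N\sum_{i=1}^N p(\mathbf{x}_i)=\int_{S^d}p\,d\sigma_d$ for every polynomial $p$ on $\mathbb{R}^{d+1}$ of degree at most $n$. A configuration of $N$ distinct points $\omega_N\subset S^d$ is $m$-sharp if it is a spherical $(2m-1)$-design and exactly $m$ distinct values occur as dot products $\mathbf{x}\cdot\mathbf{y}$ of distinct points $\mathbf{x},\mathbf{y}\in\omega_N$; it is strongly $m$-sharp if it is $m$-sharp and is also a spherical $2m$-design. *)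

(* Defs.v *)
From HB Require Import structures.
From mathcomp Require Import all_boot all_order all_algebra.
From mathcomp Require Import all_classical all_reals all_analysis.
Set Implicit Arguments. Unset Strict Implicit. Unset Printing Implicit Defensive.
Import Order.TTheory GRing.Theory Num.Theory.
Import numFieldNormedType.Exports.
Local Open Scope classical_set_scope.
Local Open Scope ring_scope.

Section Sphere.
Variable R : realType.

Definition dotp (k : nat) (x y : 'rV[R]_k) : R := \sum_(i < k) x 0 i * y 0 i.
Definition sqnorm (k : nat) (x : 'rV[R]_k) : R := dotp x x.
Definition sqdist (k : nat) (x y : 'rV[R]_k) : R := sqnorm (x - y).
Definition on_sphere (d : nat) (x : 'rV[R]_d.+1) : Prop := Num.sqrt (sqnorm x) = 1.

Fixpoint cube_int (n : nat) (F : seq R -> R) : R :=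
  match n with
  | 0 => F [::]
  | n'.+1 => \int[@lebesgue_measure R]_(t in `[(-1)%R, 1%R])
               cube_int n' (fun s => F (t :: s))
  end.

Definition row_of_seq (k : nat) (s : seq R) : 'rV[R]_k := \row_(i < k) nth 0 s i.

(* Integral against the normalized surface measure sigma_d of S^d, realized as
   the normalized cone measure: 
     int_{S^d} p dsigma_d = (1/vol(B)) int_{B \ {0}} p(x/|x|) dx,
   B the closed unit ball of R^(d+1). *)
Definition sphere_mean (d : nat) (p : 'rV[R]_d.+1 -> R) : R :=
  cube_int d.+1 (fun s => let x := row_of_seq d.+1 s in
      if (0 < sqnorm x) && (sqnorm x <= 1)
      then p ((Num.sqrt (sqnorm x))^-1 *: x) else 0)
  / cube_int d.+1 (fun s => if sqnorm (row_of_seq d.+1 s) <= 1 then 1 else 0).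

Definition poly_deg_le (k n : nat) (p : 'rV[R]_k -> R) : Prop :=
  exists s : seq (R * {ffun 'I_k -> nat}),
    (forall c, c \in s -> (\sum_(i < k) c.2 i <= n)%N) /\
    forall x, p x = \sum_(c <- s) c.1 * \prod_(i < k) x 0 i ^+ c.2 i.

Definition spherical_design (d n : nat) (omega : seq 'rV[R]_d.+1) : Prop :=
  forall p, poly_deg_le n p ->
    (size omega)%:R^-1 * \sum_(x <- omega) p x = sphere_mean p.

Definition dot_values (d : nat) (omega : seq 'rV[R]_d.+1) : seq R :=
  undup [seq dotp x y | x <- omega, y <- [seq z <- omega | z != x]].

Definition m_sharp (d m : nat) (omega : seq 'rV[R]_d.+1) : Prop :=
  [/\ uniq omega, (forall x, x \in omega -> on_sphere x),
      spherical_design (2 * m - 1) omega & size (dot_values omega) = m].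

Definition strongly_m_sharp (d m : nat) (omega : seq 'rV[R]_d.+1) : Prop :=
  m_sharp m omega /\ spherical_design (2 * m) omega.

Definition potential (d : nat) (f : R -> R) (omega : seq 'rV[R]_d.+1)
  (x : 'rV[R]_d.+1) : R := \sum_(y <- omega) f (sqdist x y).

Definition n_times_derivable_on (n : nat) (f : R -> R) (a b : R) : Prop :=
  forall k, (k < n)%N -> forall x, a < x < b -> derivable (derive1n k f) x 1.

Definition concave_on (g : R -> R) (a b : R) : Prop :=
  forall x y t, a < x < b -> a < y < b -> 0 <= t <= 1 ->
    t * g x + (1 - t) * g y <= g (t * x + (1 - t) * y).

Definition strictly_concave_on (g : R -> R) (a b : R) : Prop :=
  forall x y t, a < x < b -> a < y < b -> x != y -> 0 < t < 1 ->
    t * g x + (1 - t) * g y < g (t * x + (1 - t) * y).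

End Sphere.

(* Main.v *)
(* With respect to the squared distance s = |x - y|^2 = 2 - 2 x . y the points of
   the configuration see only the m + 1 nodes 0, s_1, ..., s_m, and s_i < 4.  Let h
   be the polynomial of degree at most 2m interpolating f at 0 and, to second
   order, at the s_i.  If f lay above h at some s, subtracting from f - h a multiple
   of s \prod (s - s_i)^2 would give a function with 2m + 2 zeros counted with
   multiplicity; by Rolle its (2m-1)-st derivative, which is strictly concave, would
   have three zeros.  Hence f <= h on [0, 4] with equality at the nodes.  Since
   \sum_i h(|x - x_i|^2) does not depend on x in S^d by the 2m-design property, the
   potential is maximal on the configuration.

   The independence of x rests on the rotation invariance of the cone measure.
   Fibre by fibre it reduces to the invariance of Lebesgue measure on R^2, where a
   rotation is a product of three shears, each of them measure preserving by Tonelli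
   and translation invariance. *)
Require Import Defs.
From HB Require Import structures.
From mathcomp Require Import all_boot all_order all_algebra.
From mathcomp Require Import all_classical all_reals all_analysis.
From mathcomp Require Import measurable_realfun ring lra zify.
Import Order.TTheory GRing.Theory Num.Theory.
Import numFieldNormedType.Exports.
Local Open Scope classical_set_scope.
Local Open Scope ring_scope.

(** * Rotation invariance of iterated integrals *)

Section RotationInvariance.
Context {R : realType}.
Local Notation mu := (@lebesgue_measure R).
Implicit Types (H K : R * R -> \bar R).

Lemma lebesgue_measureD (c : R) (A : set R) : measurable A ->
  pushforward mu (fun t : measurableTypeR R => t + c : measurableTypeR R) A = mu A.
Proof.
move=> mA; apply/esym/lebesgue_measure_unique => //=.
  exact: measurable_funD.
move=> _ _ [[a b] _ <-].
rewrite /pushforward.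
have -> : (fun t : R => t + c) @^-1` `]a, b] = `]a - c, b - c]%classic.
  by apply/seteqP; split => t /=; rewrite !in_itv /= ltrBlDr lerBrDr.
rewrite !lebesgue_measure_itv/= !lte_fin ltrD2r.
by rewrite -!EFinD opprB addrA addrNK.
Qed.

Lemma ge0_integral_translation (c : R) (f : R -> \bar R) :
  measurable_fun [set: R] f -> (forall r, 0 <= f r)%E ->
  (\int[mu]_t f (t + c)%R = \int[mu]_t f t)%E.
Proof.
move=> mf f0.
pose phi (t : measurableTypeR R) : measurableTypeR R := t + c.
have mphi : measurable_fun setT phi by exact: measurable_funD.
transitivity (\int[pushforward mu phi]_t f t)%E.
  by rewrite ge0_integral_pushforward.
by apply: eq_measure_integral => //= A mA AS; exact/lebesgue_measureD.
Qed.

Lemma tonelli_swap (k : R -> R -> \bar R) :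
  measurable_fun setT (fun z : R * R => k z.1 z.2) -> (forall x y, 0 <= k x y)%E ->
  (\int[mu]_x \int[mu]_y k x y = \int[mu]_y \int[mu]_x k x y)%E.
Proof.
move=> mk k0.
by have /= := @fubini_tonelli _ _ _ _ R mu mu _ mk (fun z => k0 z.1 z.2).
Qed.

Lemma measurable_affine2 (a b c d : R) :
  measurable_fun setT (fun z : R * R => (a * z.1 + b * z.2, c * z.1 + d * z.2)).
Proof.
by apply: measurable_fun_pair; apply: measurable_funD; apply: measurable_funM.
Qed.

Lemma integral2_shearr (a : R) K : measurable_fun setT K -> (forall z, 0 <= K z)%E ->
  (\int[mu]_x \int[mu]_y K (x, y + a * x)%R = \int[mu]_x \int[mu]_y K (x, y))%E.
Proof.
move=> mK K0; apply: eq_integral => x _.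
rewrite (ge0_integral_translation (a * x) (fun y => K (x, y)))//.
exact: measurableT_comp.
Qed.

(** Tonelli makes the sheared variable the inner one, where the shear is a translation. *)
Lemma integral2_shearl (a : R) K : measurable_fun setT K -> (forall z, 0 <= K z)%E ->
  (\int[mu]_x \int[mu]_y K (x + a * y, y)%R = \int[mu]_x \int[mu]_y K (x, y))%E.
Proof.
move=> mK K0.
transitivity (\int[mu]_y \int[mu]_x K (x + a * y, y)%R)%E.
  apply: (tonelli_swap (fun x y => K (x + a * y, y)%R)) => //.
  apply: measurableT_comp => //; apply: measurable_fun_pair => //=.
  by apply: measurable_funD => //; apply: measurable_funM.
transitivity (\int[mu]_y \int[mu]_x K (x, y))%E; last first.
  apply/esym/(tonelli_swap (fun x y => K (x, y))) => //.
  by apply: measurableT_comp => //; apply: measurable_fun_pair.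
apply: eq_integral => y _.
rewrite (ge0_integral_translation (a * y) (fun x => K (x, y)))//.
exact: measurableT_comp.
Qed.

Lemma integral2_rotation (c s : R) K :
  c ^+ 2 + s ^+ 2 = 1 -> measurable_fun setT K -> (forall z, 0 <= K z)%E ->
  (\int[mu]_x \int[mu]_y K (c * x + - s * y, s * x + c * y)%R =
   \int[mu]_x \int[mu]_y K (x, y))%E.
Proof.
move=> cs1; have three_shears c' s' K' : c' ^+ 2 + s' ^+ 2 = 1 -> 1 + c' != 0 ->
    measurable_fun setT K' -> (forall z, 0 <= K' z)%E ->
    (\int[mu]_x \int[mu]_y K' (c' * x + - s' * y, s' * x + c' * y)%R =
     \int[mu]_x \int[mu]_y K' (x, y))%E.
  (* For a rotation by theta, [t] is minus the tangent of theta / 2, and the rotation factors into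
     shears with parameters [t], [s'], [t]; the angle pi, where [1 + c'] vanishes, is excluded. *)
  move=> cs' c1 mK' K'0; pose t := - (s' / (1 + c')).
  have st : s' * t = c' - 1.
    have -> : s' * t = - (s' ^+ 2 / (1 + c')) by rewrite /t; field.
    have -> : s' ^+ 2 = 1 - c' ^+ 2 by rewrite -cs'; ring.
    by field.
  rewrite -[RHS](integral2_shearl t K' mK' K'0).
  have tc : t * (1 + c') = - s' by rewrite /t; field.
  have {st}cE : c' = 1 + s' * t by rewrite st addrC subrK.
  clearbody t.
  pose K1 (z : R * R) := K' (z.1 + t * z.2, z.2).
  have mK1 : measurable_fun setT K1.
    apply: measurableT_comp => //; have := measurable_affine2 1 t 0 1.
    by under eq_fun do rewrite !mul1r mul0r add0r.
  rewrite -[RHS](integral2_shearr s' K1 mK1 (fun=> K'0 _)).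
  pose K2 z := K1 (z.1, z.2 + s' * z.1).
  have mK2 : measurable_fun setT K2.
    apply: measurableT_comp => //; have := measurable_affine2 1 0 s' 1.
    by under eq_fun do rewrite !mul1r mul0r addr0 addrC.
  rewrite -[RHS](integral2_shearl t K2 mK2 (fun=> K'0 _)).
  apply: eq_integral => x _; apply: eq_integral => y _; congr (K' (_, _)).
    by rewrite -tc cE /=; ring.
  by rewrite cE /=; ring.
move=> mK K0; have [c1|c1] := eqVneq (1 + c) 0; last exact: three_shears.
(* The half turn is not a product of such shears, but a square of a quarter turn. *)
have cE : c = -1 by lra.
have sE : s = 0.
  by apply/eqP; rewrite -sqrf_eq0 -(inj_eq (addrI (c ^+ 2))) cs1 cE sqrrN expr1n addr0.
have mK' : measurable_fun setT (fun z : R * R => K (- z.2, z.1)).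
  apply: measurableT_comp => //; have := measurable_affine2 0 (-1) 1 0.
  by under eq_fun do rewrite !mul0r add0r mul1r addr0 mulN1r.
have e01 : 0 ^+ 2 + 1 ^+ 2 = 1 :> R by rewrite expr0n expr1n add0r.
have n01 : 1 + 0 != 0 :> R by rewrite addr0 oner_neq0.
transitivity (\int[mu]_x \int[mu]_y K (- y, x)%R)%E.
  have /= <- := three_shears 0 1 _ e01 n01 mK' (fun=> K0 _).
  apply: eq_integral => x _; apply: eq_integral => y _.
  by congr (K (_, _)); rewrite cE sE; ring.
rewrite -[RHS](three_shears 0 1 K e01 n01 mK K0).
apply: eq_integral => x _; apply: eq_integral => y _.
by congr (K (_, _)); ring.
Qed.

(* Folding [fiber_int] along the coordinates of x sends H to the map
   (u, r) |-> \int_{R^n} H (u + x . z, r + |z|^2) dz. *)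
Definition fiber_int (a : R) H (z : R * R) : \bar R :=
  (\int[mu]_t H (z.1 + a * t, z.2 + t ^+ 2)%R)%E.

Lemma fiber_int_ge0 (a : R) H z : (forall z, 0 <= H z)%E -> (0 <= fiber_int a H z)%E.
Proof. by move=> H0; apply: integral_ge0. Qed.

Lemma measurable_fiber_int (a : R) H : measurable_fun setT H ->
  (forall z, 0 <= H z)%E -> measurable_fun setT (fiber_int a H).
Proof.
move=> mH H0.
pose F (w : (R * R) * R) := H (w.1.1 + a * w.2, w.1.2 + w.2 ^+ 2).
have mF : measurable_fun setT F.
  apply: measurableT_comp => //; apply: measurable_fun_pair => /=.
    apply: measurable_funD; first exact: measurableT_comp.
    exact: measurable_funM.
  apply: measurable_funD; first exact: measurableT_comp.
  exact: measurable_funX.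
exact: (@measurable_fun_fubini_tonelli_F _ _ _ _ R mu F mF (fun=> H0 _)).
Qed.

(** The two integrations run over a plane, in which a rotation turns the linear form a x + b y into
    a multiple of the first coordinate and leaves x^2 + y^2 unchanged. *)
Lemma fiber_int_comp (a b : R) H : measurable_fun setT H -> (forall z, 0 <= H z)%E ->
  fiber_int a (fiber_int b H) = fiber_int (Num.sqrt (a ^+ 2 + b ^+ 2)) (fiber_int 0 H).
Proof.
move=> mH H0; apply/funext => -[u r]; rewrite /fiber_int /=.
set rho := Num.sqrt _.
have rho2 : rho ^+ 2 = a ^+ 2 + b ^+ 2 by rewrite sqr_sqrtr ?addr_ge0 ?sqr_ge0.
(* The rotation below divides by [rho]; for [rho = 0] both slopes vanish and the two sides
   coincide. *)
have [rho0|rho0] := eqVneq rho 0.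
  have /andP[/eqP a0 /eqP b0] : (a == 0) && (b == 0).
    by rewrite -[a == 0]sqrf_eq0 -[b == 0]sqrf_eq0 -paddr_eq0 ?sqr_ge0// -rho2 rho0 expr0n.
  by rewrite rho0 a0 b0.
pose K (z : R * R) := H (u + rho * z.1, r + z.1 ^+ 2 + z.2 ^+ 2).
have mK : measurable_fun setT K.
  apply: measurableT_comp => //; apply: measurable_fun_pair => /=.
    by apply: measurable_funD => //; exact: measurable_funM.
  apply: measurable_funD; last exact: measurable_funX.
  by apply: measurable_funD => //; exact: measurable_funX.
have cs1 : (a / rho) ^+ 2 + (- b / rho) ^+ 2 = 1.
  by rewrite !exprMn sqrrN -mulrDl -rho2 -exprMn divff// expr1n.
have := integral2_rotation (a / rho) (- b / rho) K cs1 mK (fun=> H0 _).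
rewrite /K /= => E; etransitivity; first (etransitivity; last exact: E).
  apply: eq_integral => x _; apply: eq_integral => y _; congr (H (_, _)).
    by field.
  rewrite -!addrA; congr (r + _).
  have -> : (a / rho * x + - (- b / rho) * y) ^+ 2 + (- b / rho * x + a / rho * y) ^+ 2
     = ((a / rho) ^+ 2 + (- b / rho) ^+ 2) * (x ^+ 2 + y ^+ 2) by ring.
  by rewrite cs1 mul1r.
apply: eq_integral => x _; apply: eq_integral => y _; congr (H (_, _)).
by rewrite mul0r addr0.
Qed.

Lemma foldr_fiber_int_meas H (xs : seq R) : measurable_fun setT H ->
  (forall z, 0 <= H z)%E ->
  measurable_fun setT (foldr fiber_int H xs) /\ (forall z, 0 <= foldr fiber_int H xs z)%E.
Proof.
move=> mH H0; elim: xs => [|x xs [IHm IH0]] //=; split.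
  exact: measurable_fiber_int.
by move=> z; apply: fiber_int_ge0.
Qed.

(** Merging neighbouring slopes from the right collects the Euclidean norm in front and leaves zeros
    behind, so the folded integral depends only on the length and the norm of the list. The list
    starts with two entries because it is a merge that removes the signs. *)
Lemma foldr_fiber_int_norm H (x y : R) (xs : seq R) : measurable_fun setT H ->
  (forall z, 0 <= H z)%E ->
  foldr fiber_int H (x :: y :: xs) =
  foldr fiber_int H (Num.sqrt (\sum_(t <- x :: y :: xs) t ^+ 2) :: nseq (size xs).+1 0).
Proof.
move=> mH H0; elim: xs x y => [|z xs IH] x y.
  rewrite !big_cons big_nil addr0.
  exact: fiber_int_comp.
rewrite -[LHS]/(fiber_int x (foldr fiber_int H (y :: z :: xs))) IH.
have [] := foldr_fiber_int_meas H (nseq (size xs).+1 0) mH H0.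
set ss := \sum_(t <- y :: z :: xs) _.
set N := foldr _ _ (nseq _ _) => mN N0.
rewrite -[LHS]/(fiber_int x (fiber_int (Num.sqrt ss) N)).
rewrite (fiber_int_comp x _ N mN N0) sqr_sqrtr.
  by rewrite [in RHS]big_cons.
by apply: sumr_ge0 => t _; exact: sqr_ge0.
Qed.

End RotationInvariance.

(** * Cube integrals as iterated fibre integrals *)

Section CubeIntegral.
Context {R : realType}.
Local Notation mu := (@lebesgue_measure R).

Lemma eq_cube_int (n : nat) (F1 F2 : seq R -> R) :
  (forall s, size s = n -> F1 s = F2 s) -> cube_int n F1 = cube_int n F2.
Proof.
elim: n F1 F2 => [|n IH] F1 F2 F12 /=; first exact: F12.
by apply: eq_Rintegral => t _; apply: IH => s sn; apply: F12; rewrite /= sn.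
Qed.

(** Each integration adds a square to the second argument, so vanishing beyond 1 persists. *)
Lemma foldr_fiber_int_eq0 (H : R * R -> \bar R) (xs : seq R) (u r : R) :
  (forall u r, 1 < r -> H (u, r) = 0%E) -> 1 < r -> foldr fiber_int H xs (u, r) = 0%E.
Proof.
move=> H0; elim: xs u r => [|x xs IH] u r r1; first exact: H0.
rewrite /= /fiber_int; apply: integral0_eq => t _ /=; apply: IH.
by rewrite (lt_le_trans r1)// lerDl sqr_ge0.
Qed.

(** [cube_int] is real valued and confined to [-1, 1], whereas fibre integrals are extended-real and
    run over the whole line. As r >= 0, a coordinate outside [-1, 1] pushes the second argument past
    1, where [G] vanishes; the bound [M] keeps every integral finite. *)
Lemma cube_intE (G : R * R -> R) (M : R) (xs : seq R) (u r : R) :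
  measurable_fun setT G -> (forall z, 0 <= G z <= M) ->
  (forall u r, 1 < r -> G (u, r) = 0) -> 0 <= r ->
  (cube_int (size xs) (fun s =>
     G (u + \sum_(p <- zip xs s) p.1 * p.2, r + \sum_(t <- s) t ^+ 2)))%:E
  = foldr fiber_int (EFin \o G) xs (u, r).
Proof.
move=> mG GM G0 r0.
have mE : measurable_fun setT (EFin \o G) by exact/measurable_EFinP.
have E0 z : (0 <= (EFin \o G) z)%E by rewrite lee_fin; case/andP: (GM z).
pose D : set (measurableTypeR R) := `[(-1)%R, 1%R]%classic.
have mD : measurable D by exact: measurable_itv.
(* The upper bound is carried through the induction to ensure finiteness; each integration over
   [-1, 1] contributes a factor 2. *)
suff [+ _] : (cube_int (size xs) (fun s =>
     G (u + \sum_(p <- zip xs s) p.1 * p.2, r + \sum_(t <- s) t ^+ 2)))%:E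
     = foldr fiber_int (EFin \o G) xs (u, r) /\
   (foldr fiber_int (EFin \o G) xs (u, r) <= (M * 2 ^+ size xs)%:E)%E by [].
elim: xs u r r0 => [|x xs IH] u r r0.
  by rewrite /= !big_nil !addr0 expr0 mulr1 lee_fin; case/andP: (GM (u, r)).
have [mf f0] := foldr_fiber_int_meas (EFin \o G) xs mE E0.
set f := foldr fiber_int _ xs in IH mf f0 *.
have f1 v q : 1 < q -> f (v, q) = 0%E.
  by apply: foldr_fiber_int_eq0 => v' q' q1 /=; rewrite G0.
have fx t : (0 <= f (u + x * t, r + t ^+ 2)%R)%E by exact: f0.
have mfx : measurable_fun setT (fun t : R => f (u + x * t, r + t ^+ 2)).
  apply: measurableT_comp => //; apply: measurable_fun_pair.
    by apply: measurable_funD => //; apply: measurable_funM.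
  by apply: measurable_funD => //; exact: measurable_funX.
have fE : fiber_int x f (u, r) = (\int[mu]_(t in D) f (u + x * t, r + t ^+ 2)%R)%E.
  rewrite [RHS]integral_mkcond; apply: eq_integral => t _.
  rewrite patchE; case: ifPn => //; rewrite notin_setE /D /= in_itv /= => tD.
  apply: f1; rewrite ltNge; apply: contra_notN tD => t1.
  by rewrite -ler_norml -(@ler_pXn2r _ 2)// ?nnegrE// expr1n real_normK ?num_real//
    (le_trans _ t1)// lerDr.
have le : (fiber_int x f (u, r) <= (M * 2 ^+ (size xs).+1)%:E)%E.
  rewrite fE.
  apply: (@le_trans _ _ (\int[mu]_(t in D) (cst (M * 2 ^+ size xs)%:E t))%E).
    apply: ge0_le_integral => //.
    - exact: (measurable_funTS mfx).
    - by move=> t _; case: (IH (u + x * t) (r + t ^+ 2)) => //; rewrite addr_ge0 ?sqr_ge0.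
  rewrite integral_cst// /D/= lebesgue_measure_itv /= lte_fin.
  rewrite ifT; last by lra.
  rewrite -EFinD -EFinM lee_fin exprSr mulrA.
  by rewrite opprK.
split; last exact: le.
rewrite -[RHS]/(fiber_int x f (u, r)) -[RHS]fineK; last first.
  rewrite ge0_fin_numE; first exact: le_lt_trans le (ltry _).
  by apply: fiber_int_ge0.
congr (_%:E); rewrite fE /=; congr fine; apply: eq_integral => t _.
case: (IH (u + x * t) (r + t ^+ 2)); first by rewrite addr_ge0 ?sqr_ge0.
move=> <- _; congr (_%:E); apply: eq_cube_int => s _.
by rewrite /= !big_cons /= !addrA.
Qed.

End CubeIntegral.

(** * Averages of zonal polynomials *)

Section DotProduct.
Context {R : realType} {k : nat}.
Implicit Types x y z : 'rV[R]_k.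

Lemma dotpC x y : dotp x y = dotp y x.
Proof. by apply: eq_bigr => i _; rewrite mulrC. Qed.

Lemma dotpDl x y z : dotp (x + y) z = dotp x z + dotp y z.
Proof. by rewrite -big_split; apply: eq_bigr => i _; rewrite mxE mulrDl. Qed.

Lemma dotpZl a x z : dotp (a *: x) z = a * dotp x z.
Proof. by rewrite mulr_sumr; apply: eq_bigr => i _; rewrite mxE mulrA. Qed.

Lemma sqnorm_ge0 x : 0 <= sqnorm x.
Proof. by apply: sumr_ge0 => i _; rewrite -expr2 sqr_ge0. Qed.

Lemma sqnorm_eq0 x : sqnorm x = 0 -> x = 0.
Proof.
move=> x0; apply/rowP => i; rewrite mxE; apply/eqP; rewrite -sqrf_eq0 expr2.
by apply/eqP; move: i isT; apply: psumr_eq0P => // i _; rewrite -expr2 sqr_ge0.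
Qed.

Lemma sqnormD x y : sqnorm (x + y) = sqnorm x + sqnorm y + 2 * dotp x y.
Proof.
by rewrite /sqnorm dotpDl (dotpC x) (dotpC y) !dotpDl (dotpC y x); ring.
Qed.

Lemma sqnormZ a x : sqnorm (a *: x) = a ^+ 2 * sqnorm x.
Proof. by rewrite /sqnorm dotpZl dotpC dotpZl mulrA. Qed.

Lemma sqdistE x y : sqdist x y = sqnorm x + sqnorm y - 2 * dotp x y.
Proof.
by rewrite /sqdist sqnormD -scaleN1r sqnormZ (dotpC x (_ *: _)) dotpZl (dotpC y); ring.
Qed.

(** Cauchy-Schwarz, from the nonnegative squared norm of z - (x . z) x. *)
Lemma dotp_sqr_le x z : sqnorm x = 1 -> dotp x z ^+ 2 <= sqnorm z.
Proof.
move=> x1; have := sqnorm_ge0 (z + (- dotp x z) *: x).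
by rewrite sqnormD sqnormZ x1 (dotpC z) dotpZl; nra.
Qed.

End DotProduct.

(** * Polynomial functions of bounded degree *)

Section PolyDegree.
Context {R : realType} {k : nat}.
Implicit Types p q : 'rV[R]_k -> R.

Lemma poly_deg_le_cst (c : R) : poly_deg_le 0 (fun _ : 'rV[R]_k => c).
Proof.
exists [:: (c, [ffun=> 0%N])]; split=> [_ /[1!inE] /eqP ->|x] /=.
  by rewrite big1// => i _; rewrite ffunE.
by rewrite big_seq1 /= big1 ?mulr1// => i _; rewrite ffunE.
Qed.

Lemma poly_deg_leW m n p : (m <= n)%N -> poly_deg_le m p -> poly_deg_le n p.
Proof. by move=> mn [s [sm sE]]; exists s; split=> // c /sm /leq_trans; apply. Qed.

Lemma poly_deg_leD n p q : poly_deg_le n p -> poly_deg_le n q ->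
  poly_deg_le n (fun x => p x + q x).
Proof.
move=> [s [sn sE]] [t [tn tE]]; exists (s ++ t); split=> [c|x].
  by rewrite mem_cat => /orP[/sn|/tn].
by rewrite big_cat /= sE tE.
Qed.

Lemma poly_deg_leM m n p q : poly_deg_le m p -> poly_deg_le n q ->
  poly_deg_le (m + n) (fun x => p x * q x).
Proof.
move=> [s [sn sE]] [t [tn tE]].
pose ex : Type := (R * {ffun 'I_k -> nat})%type.
exists [seq (c.1 * e.1, [ffun i => (c.2 i + e.2 i)%N]) : ex | c : ex <- s, e : ex <- t]; split.
  move=> _ /allpairsP[[c e] /= [cs et ->]] /=.
  under eq_bigr do rewrite ffunE.
  by rewrite big_split leq_add ?sn ?tn.
move=> x; rewrite sE tE big_allpairs_dep /= mulr_suml; apply: eq_bigr => c _.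
rewrite mulr_sumr; apply: eq_bigr => e _ /=.
rewrite mulrACA -big_split; congr (_ * _); apply: eq_bigr => i _.
by rewrite ffunE exprD.
Qed.

Lemma poly_deg_le_coord (i : 'I_k) : poly_deg_le 1 (fun x : 'rV[R]_k => x 0 i).
Proof.
exists [:: (1, [ffun j => (j == i) : nat])]; split=> [_ /[1!inE] /eqP ->|x] /=.
  rewrite (bigD1 i)//= ffunE eqxx big1// => j /negbTE ji.
  by rewrite ffunE ji.
rewrite big_seq1 /= mul1r (bigD1 i)//= ffunE eqxx expr1 big1 ?mulr1// => j /negbTE ji.
by rewrite ffunE ji.
Qed.

Lemma poly_deg_le_sum n (I : Type) (r : seq I) (F : I -> 'rV[R]_k -> R) :
  (forall i, poly_deg_le n (F i)) -> poly_deg_le n (fun x => \sum_(i <- r) F i x).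
Proof.
move=> Fn; elim: r => [|i r IH].
  under eq_fun do rewrite big_nil.
  exact/(@poly_deg_leW 0)/poly_deg_le_cst.
under eq_fun do rewrite big_cons.
exact: poly_deg_leD.
Qed.

Lemma poly_deg_le_horner n (h : {poly R}) p : (size h <= n.+1)%N ->
  poly_deg_le 1 p -> poly_deg_le n (fun x => h.[p x]).
Proof.
elim/poly_ind: h n => [|h c IH] n sh p1.
  under eq_fun do rewrite horner0.
  exact/(@poly_deg_leW 0)/poly_deg_le_cst.
under eq_fun do rewrite hornerMXaddC.
apply: poly_deg_leD; last exact/(@poly_deg_leW 0)/poly_deg_le_cst.
have [->|h0] := eqVneq h 0.
  under eq_fun do rewrite horner0 mul0r.
  exact/(@poly_deg_leW 0)/poly_deg_le_cst.
move: sh; rewrite size_MXaddC (negbTE h0) /= ltnS; case: n => [|n] sh.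
  by move: sh; rewrite leqn0 size_poly_eq0 (negbTE h0).
by rewrite -addn1; apply: poly_deg_leM => //; apply: IH.
Qed.

Lemma poly_deg_le_dotp (x : 'rV[R]_k) : poly_deg_le 1 (dotp x).
Proof.
apply: poly_deg_le_sum => i; apply: (@poly_deg_leM 0 1).
  exact: poly_deg_le_cst.
exact: poly_deg_le_coord.
Qed.

End PolyDegree.

(** * Independence of zonal means from their axis *)

Section ZonalMean.
Context {R : realType}.

Lemma sqnorm_row_of_seq k (s : seq R) : size s = k ->
  sqnorm (row_of_seq k s) = \sum_(t <- s) t ^+ 2.
Proof.
move=> <-; rewrite /sqnorm /dotp (big_nth 0) big_mkord.
by apply: eq_bigr => i _; rewrite mxE expr2.
Qed.

Lemma dotp_row_of_seq k (x : 'rV[R]_k) (s : seq R) : size s = k ->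
  dotp x (row_of_seq k s) = \sum_(p <- zip [seq x 0 i | i <- enum 'I_k] s) p.1 * p.2.
Proof.
move=> sk; have sz : size [seq x 0 i | i <- enum 'I_k] = k.
  by rewrite size_map size_enum_ord.
rewrite (big_nth (0, 0)) size_zip sz sk minnn big_mkord.
apply: eq_bigr => i _; rewrite nth_zip ?sz//= mxE; congr (_ * _).
by rewrite (nth_map i) ?size_enum_ord// nth_ord_enum.
Qed.

Lemma on_sphereP d (x : 'rV[R]_d.+1) : on_sphere x -> sqnorm x = 1.
Proof. by move=> x1; rewrite -[sqnorm x]sqr_sqrtr ?sqnorm_ge0// x1 expr1n. Qed.

(* Off the region u^2 <= r, which contains every pair (x . z, |z|^2) with x a
   unit vector, [zonal] is cut off so that it is bounded and nonnegative. *)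
Definition zonal (h : {poly R}) (z : R * R) : R :=
  if [&& 0 < z.2, z.2 <= 1 & z.1 ^+ 2 <= z.2] then h.[z.1 * z.2 `^ (- 2^-1)] else 0.

Lemma measurable_zonal h : measurable_fun setT (zonal h).
Proof.
apply: measurable_fun_ifT => //.
  apply: measurable_and; first by apply: measurable_fun_ltr.
  apply: measurable_and; first by apply: measurable_fun_ler.
  by apply: measurable_fun_ler => //; exact: measurable_funX.
apply: (@measurableT_comp _ _ _ _ _ _ (horner h)); first exact: measurable_poly.
apply: measurable_funM => //.
by apply: (@measurableT_comp _ _ _ _ _ _ (@powR R ^~ _)).
Qed.

Lemma zonal_arg (u r : R) : 0 < r -> u ^+ 2 <= r -> -1 <= u * r `^ (- 2^-1) <= 1.
Proof.
move=> r0 ur; have r0' := ltW r0; rewrite powRN powR12_sqrt// -ler_norml.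
rewrite -(@ler_pXn2r _ 2)// ?nnegrE// expr1n real_normK ?num_real//.
by rewrite exprMn exprVn sqr_sqrtr// ler_pdivrMr// mul1r.
Qed.

Lemma zonal_bound h : (forall t, -1 <= t <= 1 -> 0 <= h.[t]) ->
  exists M, forall z, 0 <= zonal h z <= M.
Proof.
move=> h0; have [||c cI cmax] := @EVT_max R (horner h) (-1) 1.
- by lra.
- by apply: continuous_subspaceT; exact: continuous_horner.
exists h.[c] => -[u r]; rewrite /zonal /=; case: ifPn => [/and3P[r0 _ ur]|_].
  by rewrite h0 ?zonal_arg// cmax// in_itv /= zonal_arg.
by rewrite lexx h0//; move: cI; rewrite in_itv.
Qed.

(** In the numerator the axis enters only through its list of coordinates, and the folded fibre
    integrals see only the length and the norm of that list. Nonnegativity of [h] on [-1, 1] is what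
    lets Tonelli apply. *)
Lemma sphere_mean_zonal d (h : {poly R}) (x y : 'rV[R]_d.+1) :
  (1 <= d)%N -> (forall t, -1 <= t <= 1 -> 0 <= h.[t]) ->
  on_sphere x -> on_sphere y ->
  sphere_mean (fun z => h.[dotp x z]) = sphere_mean (fun z => h.[dotp y z]).
Proof.
move=> d1 h0 /on_sphereP x1 /on_sphereP y1; rewrite /sphere_mean; congr (_ / _).
have [M hM] := zonal_bound h h0.
suff E (w : 'rV[R]_d.+1) : sqnorm w = 1 -> (cube_int d.+1 (fun s =>
    let z := row_of_seq d.+1 s in
    if (0 < sqnorm z) && (sqnorm z <= 1)
    then h.[dotp w ((Num.sqrt (sqnorm z))^-1 *: z)] else 0))%:E =
    foldr fiber_int (EFin \o zonal h) (1 :: nseq d 0) (0, 0).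
  by apply: EFin_inj; rewrite !E.
move=> w1; pose xs := [seq w 0 i | i <- enum 'I_d.+1].
have sz : size xs = d.+1 by rewrite size_map size_enum_ord.
transitivity (foldr fiber_int (EFin \o zonal h) xs (0, 0)).
  rewrite -(cube_intE _ M) ?sz//.
  - congr (_%:E); apply: eq_cube_int => s sn /=.
    rewrite !add0r -dotp_row_of_seq// -(@sqnorm_row_of_seq d.+1)//.
    set z := row_of_seq _ _; rewrite /zonal /= dotp_sqr_le// andbT.
    case: ifP => // /andP[z0 _]; congr (h.[_]).
    by rewrite powRN powR12_sqrt ?(ltW z0)// (dotpC w) dotpZl (dotpC z) mulrC.
  - exact: measurable_zonal.
  - by move=> u r r1; rewrite /zonal /= [r <= 1]leNgt r1 /= andbF.
have mE : measurable_fun setT (EFin \o zonal h).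
  by apply/measurable_EFinP; exact: measurable_zonal.
have E0 z : (0 <= (EFin \o zonal h) z)%E by rewrite lee_fin; case/andP: (hM z).
have : \sum_(t <- xs) t ^+ 2 = 1.
  by rewrite -w1 big_map big_enum; apply: eq_bigr => i _; rewrite expr2.
(* As d >= 1 there are at least two coordinates to merge; shorter lists are refuted. *)
move: sz; case: xs => [|a [|b xs]] // sz ss.
  by move: d1; case: sz => <-.
have -> := foldr_fiber_int_norm _ a b xs mE E0.
by rewrite ss sqrtr1; case: sz => <-.
Qed.

(** The design property turns both sums into spherical means of zonal polynomials. Subtracting from
    [h] its minimum on [-1, 1] provides the sign needed for axis independence and shifts both sums
    equally. *)
Lemma design_zonal_sum d n (omega : seq 'rV[R]_d.+1) (h : {poly R}) x y :
  (1 <= d)%N -> spherical_design n omega -> (size h <= n.+1)%N ->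
  on_sphere x -> on_sphere y ->
  \sum_(z <- omega) h.[dotp x z] = \sum_(z <- omega) h.[dotp y z].
Proof.
move=> d1 des sh xS yS; have [->|o0] := eqVneq omega [::].
  by rewrite !big_nil.
have [||c cI cmin] := @EVT_min R (horner h) (-1) 1.
- by lra.
- by apply: continuous_subspaceT; exact: continuous_horner.
pose g := h + (- h.[c])%:P.
have gE t : g.[t] = h.[t] - h.[c] by rewrite /g hornerD hornerC.
have sg : (size g <= n.+1)%N.
  rewrite (leq_trans (size_polyD _ _))// geq_max sh.
  by rewrite (leq_trans (size_polyC_leq1 _)).
have g0 t : -1 <= t <= 1 -> 0 <= g.[t].
  by move=> t1; rewrite gE subr_ge0 cmin// in_itv.
have N0 : (size omega)%:R^-1 != 0 :> R by rewrite invr_eq0 pnatr_eq0 size_eq0.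
have gdeg w : poly_deg_le n (fun z => g.[dotp w z]).
  by apply: poly_deg_le_horner => //; exact: poly_deg_le_dotp.
have : \sum_(z <- omega) g.[dotp x z] = \sum_(z <- omega) g.[dotp y z].
  apply: (mulfI N0).
  rewrite (des (fun z => g.[dotp x z]))// (des (fun z => g.[dotp y z]))//.
  exact: sphere_mean_zonal.
under eq_bigr do rewrite gE.
under [RHS]eq_bigr do rewrite gE.
by rewrite !big_split /= => /addIr.
Qed.

End ZonalMean.

(** * Hermite interpolation and Rolle's theorem *)

Section HermiteInterpolation.
Context {F : fieldType}.

(** Induction on the nodes: P^2 vanishes to second order at the earlier ones, so adding P^2 (a + b
    (X - x)) leaves the data there intact, and a, b solve a triangular system for the value and the
    derivative at x. *)
Lemma hermite_interpolation (xs : seq F) (v w : F -> F) : uniq xs ->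
  exists2 h : {poly F}, (size h <= 2 * size xs)%N &
    forall x, x \in xs -> h.[x] = v x /\ h^`().[x] = w x.
Proof.
elim: xs => [_|x xs IH /= /andP[xxs uxs]].
  by exists 0 => //; rewrite size_poly0.
have [h sh hE] := IH uxs.
pose P := \prod_(y <- xs) ('X - y%:P).
have Px : P.[x] != 0 by rewrite -[_ == 0]/(root P x) root_prod_XsubC.
pose a := (v x - h.[x]) / P.[x] ^+ 2.
pose b := (w x - h^`().[x] - 2 * P.[x] * P^`().[x] * a) / P.[x] ^+ 2.
have aE : a * P.[x] ^+ 2 = v x - h.[x] by rewrite divfK ?expf_neq0.
have bE : b * P.[x] ^+ 2 = w x - h^`().[x] - 2 * P.[x] * P^`().[x] * a.
  by rewrite divfK ?expf_neq0.
clearbody a b.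
exists (h + P ^+ 2 * (a%:P + b *: ('X - x%:P))).
  rewrite (leq_trans (size_polyD _ _))// geq_max; apply/andP; split.
    by rewrite (leq_trans sh)// leq_mul2l leqnSn orbT.
  rewrite (leq_trans (size_polyMleq _ _))//.
  have s1 : (size (P ^+ 2)%R <= (2 * size xs).+1)%N.
    by rewrite expr2 (leq_trans (size_polyMleq _ _))// !size_prod_XsubC; lia.
  have s2 : (size (a%:P + b *: ('X - x%:P))%R <= 2)%N.
    rewrite (leq_trans (size_polyD _ _))// geq_max (leq_trans (size_polyC_leq1 _))//=.
    by rewrite (leq_trans (size_scale_leq _ _))// size_XsubC.
  by move: (leq_add s1 s2) => /=; rewrite -ltnS mulnS; case: (_ + _)%N; lia.
move=> y; rewrite inE => /orP[/eqP ->|yxs].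
  rewrite !(poly.derivE, hornerE) /=; split.
    by rewrite subrr mulr0 addr0 mulrC aE addrC subrK.
  transitivity (h^`().[x] + 2 * P.[x] * P^`().[x] * a + b * P.[x] ^+ 2).
    by ring.
  by rewrite bE; ring.
have Py : P.[y] = 0 by apply/eqP; rewrite -[_ == 0]/(root P y) root_prod_XsubC.
have [hy h'y] := hE y yxs.
rewrite !(poly.derivE, hornerE) /= Py hy h'y; split; first by ring.
by ring.
Qed.

(** The simple node costs one more coefficient: a multiple of P^2 corrects the value at [a] without
    disturbing the double nodes. *)
Lemma hermite_interpolation_simple (a : F) (xs : seq F) (v w : F -> F) :
  uniq (a :: xs) ->
  exists h : {poly F}, [/\ (size h <= (2 * size xs).+1)%N, h.[a] = v a &
    forall x, x \in xs -> h.[x] = v x /\ h^`().[x] = w x].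
Proof.
move=> /= /andP[axs uxs]; have [h sh hE] := hermite_interpolation xs v w uxs.
pose P := \prod_(y <- xs) ('X - y%:P).
have Pa : P.[a] != 0 by rewrite -[_ == 0]/(root P a) root_prod_XsubC.
pose c := (v a - h.[a]) / P.[a] ^+ 2.
have cE : c * P.[a] ^+ 2 = v a - h.[a] by rewrite divfK ?expf_neq0.
clearbody c; exists (h + c *: P ^+ 2); split.
- rewrite (leq_trans (size_polyD _ _))// geq_max (leq_trans sh)//=.
  rewrite (leq_trans (size_scale_leq _ _))// expr2.
  by rewrite (leq_trans (size_polyMleq _ _))// !size_prod_XsubC; lia.
- by rewrite hornerD hornerZ horner_exp cE addrC subrK.
move=> x xxs; have [hx h'x] := hE x xxs.
have Px : P.[x] = 0 by apply/eqP; rewrite -[_ == 0]/(root P x) root_prod_XsubC.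
by rewrite !(poly.derivE, hornerE) /= Px hx h'x; split; ring.
Qed.

End HermiteInterpolation.

(** * Counting zeros of derivatives *)

Section Rolle.
Context {R : realType}.
Implicit Types (a b : R) (zs : seq R).

(** Rolle's theorem between neighbours. The zeros found avoid the original ones, so that they can be
    counted together with double zeros. The endpoints [a] and [b] may be among the original zeros,
    hence the separate continuity assumption. *)
Lemma rolle_path a b (g g' : R -> R) x zs :
  path <%R x zs -> (forall z, z \in x :: zs -> a <= z <= b) ->
  (forall y z, y \in x :: zs -> z \in x :: zs -> {within `[y, z], continuous g}) ->
  (forall t, a < t < b -> is_derive t 1 g (g' t)) ->
  (forall z, z \in x :: zs -> g z = 0) ->
  exists cs : seq R, [/\ path <%R x cs, size cs = size zs &
    forall c, c \in cs -> [/\ a < c < b, c \notin x :: zs & g' c = 0]].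
Proof.
elim: zs x => [|y zs IH] x; first by exists [::].
rewrite [path _ _ _]/= => /andP[xy pyzs] ab cg dg g0.
have [|||cs [pcs scs csP]] := IH y pyzs.
- by move=> z zs'; apply: ab; rewrite inE zs' orbT.
- by move=> u v us vs; apply: cg; rewrite inE ?us ?vs orbT.
- by move=> z zs'; apply: g0; rewrite inE zs' orbT.
have /andP[ax _] : a <= x <= b by apply: ab; rewrite mem_head.
have /andP[_ yb] : a <= y <= b by apply: ab; rewrite !inE eqxx orbT.
have xyI t : t \in `]x, y[%R -> a < t < b.
  by rewrite in_itv /= => /andP[xt ty]; rewrite (le_lt_trans ax xt) (lt_le_trans ty yb).
have [|||c cI dc] := @Rolle R g x y xy.
- by move=> t /xyI /dg [].
- by apply: cg; rewrite !inE eqxx ?orbT.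
- by rewrite !g0// !inE eqxx ?orbT.
have [/andP[xc cy] cab] : x < c < y /\ a < c < b by split; [rewrite in_itv in cI | exact: xyI].
have gtpath (u : R) s : path <%R u s -> forall v, v \in s -> u < v.
  move=> /(order_path_min lt_trans) /allP; exact.
exists (c :: cs); split.
- rewrite /= xc /=; case: (cs) pcs => //= c' cs' /andP[yc' ->].
  by rewrite (lt_trans cy yc').
- by rewrite /= scs.
move=> c'; rewrite inE => /orP[/eqP ->|c'cs].
  split=> //; last first.
    have /@derive_val <- := dg c cab; exact: derive_val.
  rewrite !inE !negb_or gt_eqF// lt_eqF//=.
  by apply/negP => /(gtpath _ _ pyzs); rewrite ltNge ltW.
have [c'ab c'n c'0] := csP c' c'cs; split=> //.
by rewrite inE negb_or c'n andbT gt_eqF// (lt_trans xy)// (gtpath _ _ pcs).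
Qed.

Lemma rolle_uniq a b (g g' : R -> R) zs :
  uniq zs -> (forall z, z \in zs -> a <= z <= b) ->
  (forall y z, y \in zs -> z \in zs -> {within `[y, z], continuous g}) ->
  (forall t, a < t < b -> is_derive t 1 g (g' t)) ->
  (forall z, z \in zs -> g z = 0) ->
  exists cs : seq R, [/\ uniq cs, size cs = (size zs).-1 &
    forall c, c \in cs -> [/\ a < c < b, c \notin zs & g' c = 0]].
Proof.
move=> uzs ab cg dg g0.
have : sorted <%R (sort <=%R zs) by rewrite lt_sorted_uniq_le sort_uniq uzs sort_le_sorted.
have := mem_sort <=%R zs; have := size_sort <=%R zs.
case: (sort _ _) => [|x s] /= sz ms pxs.
  by exists [::]; rewrite -sz.
have [|||cs [pcs scs csP]] := @rolle_path a b g g' x s pxs.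
- by move=> z; rewrite ms; exact: ab.
- by move=> y z; rewrite !ms; exact: cg.
- by move=> z; rewrite ms; exact: g0.
exists cs; split.
- by apply: (@sorted_uniq _ <%R lt_trans ltxx); exact: path_sorted pcs.
- by rewrite scs -sz.
- by move=> c /csP; rewrite ms.
Qed.

(** Each differentiation loses one zero, truncated subtraction covering lists that run out. All
    zeros lie in the open interval, where continuity follows from differentiability. *)
Lemma rolle_iter a b (g : nat -> R -> R) n zs :
  uniq zs -> (forall z, z \in zs -> a < z < b) ->
  (forall k, (k < n)%N -> forall t, a < t < b -> is_derive t 1 (g k) (g k.+1 t)) ->
  (forall z, z \in zs -> g 0%N z = 0) ->
  exists cs : seq R, [/\ uniq cs, size cs = (size zs - n)%N &
    forall c, c \in cs -> a < c < b /\ g n c = 0].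
Proof.
elim: n g zs => [|n IH] g zs uzs ab dg g0.
  by exists zs; rewrite subn0; split=> // c czs; rewrite ab// g0.
have dg0 := dg 0%N isT.
have [|||cs [ucs scs csP]] := @rolle_uniq a b (g 0%N) (g 1%N) zs uzs.
- by move=> z /ab /andP[/ltW -> /ltW ->].
- move=> y z /ab/andP[ay _] /ab/andP[_ zb].
  apply: derivable_within_continuous => t; rewrite in_itv /= => /andP[yt tz].
  have tab : a < t < b by rewrite (lt_le_trans ay yt) (le_lt_trans tz zb).
  by case: (dg0 t tab).
- exact: g0.
have [|||ds [uds sds dsP]] := IH (fun k => g k.+1) cs ucs.
- by move=> c /csP[].
- by move=> k kn; apply: dg.
- by move=> c /csP[].
by exists ds; split=> //; rewrite sds scs; lia.
Qed.

(** The middle one of three zeros is a convex combination of the outer two, so strict concavity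
    would make [F] positive there. *)
Lemma strictly_concave_zeros a b (F : R -> R) zs : strictly_concave_on F a b ->
  uniq zs -> (2 < size zs)%N -> (forall z, z \in zs -> a < z < b /\ F z = 0) -> False.
Proof.
move=> cF uzs szs zsP.
have : sorted <%R (sort <=%R zs) by rewrite lt_sorted_uniq_le sort_uniq uzs sort_le_sorted.
have := mem_sort <=%R zs; move: szs; rewrite -(size_sort <=%R zs).
case: (sort _ _) => [|x [|y [|z s]]] //= _ ms /and3P[xy yz _].
have [|xab Fx] := zsP x; first by rewrite -ms inE eqxx.
have [|yab Fy] := zsP y; first by rewrite -ms !inE eqxx orbT.
have [|zab Fz] := zsP z; first by rewrite -ms !inE eqxx !orbT.
have zx : 0 < z - x by rewrite subr_gt0 (lt_trans xy).
have := cF x z ((z - y) / (z - x)) xab zab.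
rewrite Fx Fz !mulr0 addr0 lt_eqF ?(lt_trans xy)//.
have -> : (z - y) / (z - x) * x + (1 - (z - y) / (z - x)) * z = y.
  by field; rewrite gt_eqF.
have t01 : 0 < (z - y) / (z - x) < 1.
  apply/andP; split; first by rewrite divr_gt0 // subr_gt0.
  by rewrite ltr_pdivrMr// mul1r ltrD2l ltrN2.
by rewrite Fy ltxx => /(_ isT t01).
Qed.

(** The Jensen gap of a quadratic is its second coefficient times t (1 - t) (x - y)^2. Strictness
    comes either from this gap or from [F] itself. *)
Lemma concave_sub_quadratic a b (F : R -> R) (q : {poly R}) :
  (size q <= 3)%N -> 0 <= q`_2 -> concave_on F a b ->
  (0 < q`_2 \/ strictly_concave_on F a b) ->
  strictly_concave_on (fun x => F x - q.[x]) a b.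
Proof.
move=> sq q2 cF sF x y t xab yab xy t01.
have qE z : q.[z] = q`_0 + q`_1 * z + q`_2 * z ^+ 2.
  rewrite (horner_coef_wide z sq) !big_ord_recr big_ord0 /=.
  by rewrite add0r expr0 expr1 mulr1.
have gap : t * q.[x] + (1 - t) * q.[y] - q.[t * x + (1 - t) * y] =
    q`_2 * (t * (1 - t) * (x - y) ^+ 2) by rewrite !qE; ring.
have pos : 0 < t * (1 - t) * (x - y) ^+ 2.
  have xy2 : 0 < (x - y) ^+ 2 by rewrite exprn_even_gt0 //= subr_eq0.
  case/andP: t01 => t0 t1; apply: mulr_gt0 => //.
  by apply: mulr_gt0 => //; rewrite subr_gt0.
have cF' := cF x y t xab yab.
have {}cF' : t * F x + (1 - t) * F y <= F (t * x + (1 - t) * y).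
  by apply: cF'; case/andP: t01 => /ltW -> /ltW ->.
case: sF => [q2'|sF].
  by have := mulr_gt0 q2' pos; rewrite -gap; lra.
have sF' := sF x y t xab yab xy t01.
by have := mulr_ge0 q2 (ltW pos); rewrite -gap; lra.
Qed.

End Rolle.

(** * Sign of the interpolation error *)

Section HermiteError.
Context {R : realType}.

Lemma is_derive_derive1n_sub_horner n (f : R -> R) a b (q : {poly R}) :
  n_times_derivable_on n f a b ->
  forall k, (k < n)%N -> forall t, a < t < b ->
    is_derive t 1 (fun x => derive1n k f x - (q^`(k)).[x])
      (derive1n k.+1 f t - (q^`(k.+1)).[t]).
Proof.
move=> fn k kn t tab.
have fk : is_derive t 1 (derive1n k f) (derive1n k.+1 f t).
  by apply: DeriveDef; [exact: fn | rewrite derive1nS derive1E].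
have qk := is_derive_poly q^`(k) t; rewrite derivnS.
exact: is_deriveB.
Qed.

(** The two alternatives serve different ends: the strict inequality yields the majorization f <= h,
    and the one allowing equality shows that under strict concavity f and h touch only at the
    nodes. *)
Lemma hermite_interpolant_not_below n (f : R -> R) a b (xs : seq R) (h : {poly R}) s :
  n.+1 = (2 * size xs)%N ->
  {within `[a, b], continuous f} -> n_times_derivable_on n f a b ->
  concave_on (derive1n n f) a b ->
  uniq xs -> (forall x, x \in xs -> a < x < b) ->
  (size h <= (2 * size xs).+1)%N -> h.[a] = f a ->
  (forall x, x \in xs -> h.[x] = f x /\ h^`().[x] = derive1 f x) ->
  a < s <= b -> s \notin xs ->
  h.[s] < f s \/ h.[s] <= f s /\ strictly_concave_on (derive1n n f) a b -> False.
Proof.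
move=> nm fc fn cf uxs xab sh ha hx /andP[as_ sb] sxs hs.
have le_hs : h.[s] <= f s by case: hs => [/ltW|[]].
pose P := \prod_(x <- xs) ('X - x%:P).
pose W := ('X - a%:P) * P ^+ 2.
have mW : W \is monic by rewrite monicMl ?monicXsubC// monic_exp// monic_prod_XsubC.
have sW : size W = (2 * size xs).+2.
  rewrite size_Mmonic ?monic_exp ?monic_prod_XsubC ?polyXsubC_eq0//.
  rewrite size_XsubC expr2 size_Mmonic ?monic_prod_XsubC ?monic_neq0 ?monic_prod_XsubC//.
  by rewrite size_prod_XsubC; lia.
have Px x : x \in xs -> P.[x] = 0.
  by move=> xxs; apply/eqP; rewrite -[_ == 0]/(root P x) root_prod_XsubC.
have Wx x : x \in xs -> W.[x] = 0 /\ W^`().[x] = 0.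
  by move=> /Px Px0; rewrite !(poly.derivE, hornerE) /= Px0; split; ring.
have Wa : W.[a] = 0 by rewrite hornerM hornerXsubC subrr mul0r.
have Ws : 0 < W.[s].
  rewrite hornerM hornerXsubC horner_exp mulr_gt0 ?subr_gt0//.
  rewrite exprn_even_gt0 //= -[_ == 0]/(root P s) root_prod_XsubC//.
(* chosen such that q = h + l W also interpolates f at s *)
pose l := (f s - h.[s]) / W.[s].
have l0 : 0 <= l by rewrite divr_ge0 ?subr_ge0// ltW.
pose q := h + l *: W.
have qs : q.[s] = f s by rewrite hornerD hornerZ divfK ?gt_eqF// addrC subrK.
have qa : q.[a] = f a by rewrite hornerD hornerZ Wa mulr0 addr0.
have qx x : x \in xs -> q.[x] = f x /\ q^`().[x] = derive1 f x.
  move=> xxs; have [Wx0 W'x0] := Wx x xxs; have [hx0 h'x0] := hx x xxs.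
  by rewrite derivD derivZ !hornerD !hornerZ Wx0 W'x0 !mulr0 !addr0.
have sq : (size q <= (2 * size xs).+2)%N.
  rewrite (leq_trans (size_polyD _ _))// geq_max (leq_trans sh)//=.
  by rewrite (leq_trans (size_scale_leq _ _))// sW.
pose g k x := derive1n k f x - (q^`(k)).[x].
have dg := is_derive_derive1n_sub_horner n f a b q fn.
have xin x : x \in xs -> a <= x <= b by move=> /xab /andP[/ltW -> /ltW ->].
have n0 : (0 < n)%N.
  have : (0 < size xs)%N by lia.
  by lia.
have zab z : z \in [:: a, s & xs] -> a <= z <= b.
  have ab : a <= b by rewrite (le_trans (ltW as_)).
  rewrite !inE => /or3P[/eqP ->|/eqP ->|/xin//]; first by rewrite lexx.
  by rewrite (ltW as_).
have dg0 := dg 0%N n0.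
(* Let m be the number of double nodes. The m + 2 zeros include [a] and possibly [b], where f is
   only known to be continuous, so the first Rolle step is done on the closed interval; it yields m
   + 1 zeros. *)
have [||||cs [ucs scs csP]] := @rolle_uniq R a b (g 0%N) (g 1%N) (a :: s :: xs).
- rewrite /= uxs sxs inE negb_or lt_eqF//= !andbT.
  by apply/negP => /xab; rewrite ltxx.
- exact: zab.
- move=> y z /zab /andP[ay _] /zab /andP[_ zb].
  apply: (@continuous_subspaceW _ _ _ `[a, b]%classic).
    move=> t; rewrite /= !in_itv /= => /andP[yt tz].
    by rewrite (le_trans ay yt) (le_trans tz zb).
  move=> t; apply: continuousB; first exact: fc.
  exact: continuous_subspaceT (@continuous_horner _ q) t.
- by move=> z; rewrite /g /= !inE => /or3P[/eqP ->|/eqP ->|/qx[-> _]];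
    rewrite ?qa ?qs subrr.

have nE : n = n.-1.+1 by rewrite prednK.
(* The double nodes raise the number of zeros of the first derivative to 2m + 1; the remaining n - 1
   = 2m - 2 differentiations leave three. *)
have [||||ds [uds sds dsP]] := @rolle_iter R a b (fun k => g k.+1) n.-1 (cs ++ xs).
- rewrite cat_uniq ucs uxs andbT /=; apply/hasPn => x xxs /=.
  by apply/negP => /csP[_]; rewrite !inE xxs !orbT.
- by move=> z; rewrite mem_cat => /orP[/csP[]//|/xab].
- by move=> k kn t tab; apply: dg => //; rewrite nE ltnS.
- move=> z; rewrite mem_cat => /orP[/csP[]//|/qx[_ q'z]].
  by rewrite /g derivn1 q'z derive1n1 subrr.
(* The degree n + 2 = 2m + 1 is out of reach of [h], and [W] is monic of that degree, so [l] is the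
   coefficient of [q] there. *)
have qn2 : (q^`(n))`_2 = l *+ (n.+2) ^_ n.
  rewrite coef_derivn addn2 coefD coefZ nth_default; last by rewrite (leq_trans sh)// -nm.
  by have := monicP mW; rewrite lead_coefE sW -nm /= => ->; rewrite add0r mulr1.
apply: (@strictly_concave_zeros R a b (g n) ds).
- apply: concave_sub_quadratic => //.
  + apply/leq_sizeP => j j3; rewrite coef_derivn nth_default ?mul0rn//.
    by rewrite (leq_trans sq)// -nm; lia.
  + by rewrite qn2 mulrn_wge0.
  + case: hs => [hs|[_ ?]]; [left | by right].
    by rewrite qn2 pmulrn_rgt0 ?ffact_gt0 ?leqW// divr_gt0 ?subr_gt0.
- exact: uds.
- by rewrite sds size_cat scs /=; lia.
by move=> z /dsP; rewrite nE.
Qed.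

End HermiteError.

(** * Sharp configurations *)

Section SharpConfigurations.
Context {R : realType} {d : nat}.
Implicit Types (x y z : 'rV[R]_d.+1) (omega : seq 'rV[R]_d.+1).

Lemma sqdist_sphere x y : on_sphere x -> on_sphere y -> sqdist x y = 2 - 2 * dotp x y.
Proof. by move=> /on_sphereP x1 /on_sphereP y1; rewrite sqdistE x1 y1. Qed.

Lemma sqdist_eq0 x y : sqdist x y = 0 -> x = y.
Proof. by move=> /sqnorm_eq0 /eqP; rewrite subr_eq0 => /eqP. Qed.

Lemma dotp_sphere_itv x y : on_sphere x -> on_sphere y -> -1 <= dotp x y <= 1.
Proof.
move=> /on_sphereP x1 /on_sphereP y1; have := dotp_sqr_le x y x1.
by rewrite y1 -ler_norml => xy; rewrite -(@ler_pXn2r _ 2)// ?nnegrE// expr1n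
  real_normK ?num_real.
Qed.

Lemma sqdist_sphere_itv x y : on_sphere x -> on_sphere y -> 0 <= sqdist x y <= 4.
Proof.
by move=> xS yS; have := dotp_sphere_itv x y xS yS; rewrite sqdist_sphere//; lra.
Qed.

Lemma mem_dot_values omega x y : x \in omega -> y \in omega -> x != y ->
  dotp x y \in dot_values omega.
Proof.
move=> xo yo xy; rewrite mem_undup; apply/allpairsPdep; exists x, y; split=> //.
by rewrite mem_filter eq_sym xy.
Qed.

Lemma dot_valuesP omega t : t \in dot_values omega ->
  exists x y, [/\ x \in omega, y \in omega, x != y & t = dotp x y].
Proof.
rewrite mem_undup => /allpairsPdep[x [y [xo]]].
by rewrite mem_filter => /andP[yx yo] ->; exists x, y; rewrite eq_sym.
Qed.

(** The point is c x + sqrt (1 - c^2) v / |v| with v orthogonal to x; such a v exists because the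
    kernel of a column with d + 1 entries has dimension at least d >= 1. *)
Lemma exists_dotp x (c : R) : (1 <= d)%N -> on_sphere x -> -1 <= c <= 1 ->
  exists2 y, on_sphere y & dotp y x = c.
Proof.
move=> d1 /on_sphereP x1 c1.
have [v v0 vx] : exists2 v : 'rV[R]_d.+1, v != 0 & dotp v x = 0.
  exists (nz_row (kermx x^T)).
    rewrite nz_row_eq0 -mxrank_eq0 mxrank_ker -lt0n subn_gt0.
    by rewrite (leq_ltn_trans (rank_leq_col _)).
  have /sub_kermxP/matrixP/(_ 0 0) := nz_row_sub (kermx x^T).
  by rewrite !mxE => <-; apply: eq_bigr => i _; rewrite mxE.
have n0 : 0 < sqnorm v.
  rewrite lt0r sqnorm_ge0 andbT; apply: contra_neq v0; exact: sqnorm_eq0.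
have c2 : 0 <= 1 - c ^+ 2 by nra.
exists (c *: x + Num.sqrt ((1 - c ^+ 2) / sqnorm v) *: v).
  rewrite /on_sphere sqnormD !sqnormZ x1 sqr_sqrtr ?divr_ge0 ?sqnorm_ge0//.
  rewrite dotpZl dotpC dotpZl vx !mulr0 addr0 mulr1 divfK ?gt_eqF//.
  by rewrite addrC subrK sqrtr1.
by rewrite dotpDl !dotpZl vx mulr0 addr0 -[dotp x x]/(sqnorm x) x1 mulr1.
Qed.

(** The reciprocals of 1, ..., [size q] lie in the interval and are too many roots for a nonzero
    polynomial. *)
Lemma poly_vanishing_on_itv (q : {poly R}) :
  (forall c, -1 <= c <= 1 -> root q c) -> q = 0.
Proof.
move=> q0; apply/eqP/negPn/negP => qn0.
pose rs := [seq (i.+1%:R : R)^-1 | i <- iota 0 (size q)].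
have : (size rs < size q)%N.
  apply: max_poly_roots => //.
    apply/allP => _ /mapP[i _ ->]; apply: q0.
    have i1 : 1 <= i.+1%:R :> R by rewrite ler1n.
    have i0 : 0 < i.+1%:R^-1 :> R by rewrite invr_gt0 ltr0n.
    have i2 : i.+1%:R^-1 <= 1 :> R by rewrite invf_le1 ?ltr0n.
    by rewrite i2 (le_trans (lerN10 R) (ltW i0)).
  rewrite map_inj_uniq ?iota_uniq// => i j /invr_inj /eqP.
  by rewrite eqr_nat => /eqP[].
by rewrite size_map size_iota ltnn.
Qed.

Lemma sum_seq_eq0 (T : eqType) (r : seq T) (F : T -> R) :
  (forall i, i \in r -> 0 <= F i) -> \sum_(i <- r) F i = 0 ->
  forall i, i \in r -> F i = 0.
Proof.
move=> F0 /eqP; rewrite big_seq psumr_eq0// => /allP Fr i ir.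
by have := Fr i ir; rewrite ir => /eqP.
Qed.

(* A value -1 would give the polynomial (1 - t^2) \prod (t - t_i)^2 of degree 2m,
   nonnegative on [-1, 1] and vanishing at all scalar products of the
   configuration; by the design property it would vanish on [-1, 1]. *)
Lemma strongly_sharp_not_antipodal m omega : (1 <= d)%N -> strongly_m_sharp m omega ->
  -1 \notin dot_values omega.
Proof.
move=> d1 [[uo oS _ sT] des]; apply/negP => aT.
have [x0 [y0 [x0o _ _ _]]] := dot_valuesP _ _ aT.
(* Removing -1 keeps the degree of [q] at 2 + 2 (m - 1) = 2m, within the strength of the design. *)
pose T' := rem (-1) (dot_values omega).
pose P := \prod_(t <- T') ('X - t%:P).
pose q : {poly R} := (1 - 'X^2) * P ^+ 2.
have qE t : q.[t] = (1 - t ^+ 2) * P.[t] ^+ 2.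
  by rewrite hornerM horner_exp hornerD hornerN hornerXn hornerC.
have q0 t : -1 <= t <= 1 -> 0 <= q.[t].
  by move=> t1; rewrite qE mulr_ge0 ?sqr_ge0//; nra.
have sq : (size q <= (2 * m).+1)%N.
  rewrite (leq_trans (size_polyMleq _ _))//.
  have s1 : (size (1 - 'X^2 : {poly R})%R <= 3)%N.
    rewrite (leq_trans (size_polyD _ _))// size_polyN size_polyXn size_poly1//.
  have m0 : (0 < m)%N by rewrite -sT; case: (dot_values omega) aT.
  have s2 : (size (P ^+ 2)%R <= (2 * m).-1)%N.
    rewrite expr2 (leq_trans (size_polyMleq _ _))// !size_prod_XsubC size_rem// sT.
    by lia.
  by move: (leq_add s1 s2); case: (_ + _)%N; lia.
have qx x : on_sphere x -> q.[dotp x x0] = 0.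
  move=> xS.
  have : \sum_(z <- omega) q.[dotp x z] = 0.
    (* At [x0] every term vanishes: 1 - t^2 kills the products 1 and -1, and [P] the others. So the
       sum at an arbitrary [x] vanishes too, and nonnegativity makes it vanish termwise. *)
    rewrite (design_zonal_sum d _ omega q x x0 d1 des sq xS (oS x0 x0o)).
    rewrite big_seq big1// => z zo; rewrite qE.
    have [<-|x0z] := eqVneq x0 z.
      have /on_sphereP x01 := oS x0 x0o.
      by rewrite -[dotp x0 x0]/(sqnorm x0) x01 expr1n subrr mul0r.
    have [->|n1] := eqVneq (dotp x0 z) (-1); first by rewrite sqrrN expr1n subrr mul0r.
    suff -> : P.[dotp x0 z] = 0 by rewrite expr0n mulr0.
    apply/eqP; rewrite -[_ == 0]/(root P _) root_prod_XsubC.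
    by rewrite mem_rem_uniq ?undup_uniq// inE n1 mem_dot_values.
  move=> /sum_seq_eq0; apply=> // z zo.
  by apply: q0; apply: dotp_sphere_itv => //; exact: oS.
have : q = 0.
  apply: poly_vanishing_on_itv => c c1.
  have [x xS <-] := exists_dotp x0 c d1 (oS x0 x0o) c1.
  by apply/eqP; exact: qx.
apply/eqP/mulf_neq0; last by rewrite expf_neq0// monic_neq0// monic_prod_XsubC.
by rewrite -size_poly_eq0 addrC size_polyDl size_polyN size_polyXn// size_poly1.
Qed.

(** The substitution s = 2 - 2t is affine, so the degree bound survives. *)
Lemma design_sqdist_sum n omega (h : {poly R}) x y : (1 <= d)%N ->
  (forall z, z \in omega -> on_sphere z) -> spherical_design n omega ->
  (size h <= n.+1)%N -> on_sphere x -> on_sphere y ->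
  \sum_(z <- omega) h.[sqdist x z] = \sum_(z <- omega) h.[sqdist y z].
Proof.
move=> d1 oS des sh xS yS.
pose g := h \Po (2%:P - 2 *: 'X).
have gE w : on_sphere w -> \sum_(z <- omega) h.[sqdist w z] = \sum_(z <- omega) g.[dotp w z].
  move=> wS; rewrite !big_seq; apply: eq_bigr => z zo.
  by rewrite (sqdist_sphere _ _ wS (oS z zo)) horner_comp !hornerE.
rewrite !gE//; apply: (design_zonal_sum d n) => //.
rewrite (leq_trans (size_comp_poly_leq _ _))// ltnS.
have : (size (2%:P - 2 *: 'X : {poly R})%R <= 2)%N.
  rewrite (leq_trans (size_polyD _ _))// geq_max (leq_trans (size_polyC_leq1 _))//.
  by rewrite size_polyN (leq_trans (size_scale_leq _ _))// size_polyX.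
by nia.
Qed.

End SharpConfigurations.

(** * Absolute maxima of the potential *)

Theorem theorem2p3 (R : realType) (m d : nat) (f : R -> R)
  (omega : seq 'rV[R]_d.+1) :
  (1 <= m)%N -> (1 <= d)%N ->
  {within `[0%R, 4%R], continuous f} ->
  n_times_derivable_on (2 * m - 1) f 0 4 ->
  concave_on (derive1n (2 * m - 1) f) 0 4 ->
  strongly_m_sharp m omega ->
  (forall y, y \in omega -> forall x, on_sphere x ->
      potential f omega x <= potential f omega y) /\
  (strictly_concave_on (derive1n (2 * m - 1) f) 0 4 ->
   forall x, on_sphere x ->
     (forall z, on_sphere z -> potential f omega z <= potential f omega x) ->
     x \in omega).
Proof.
move=> m1 d1 fc fn fcc sharp.
have aT := strongly_sharp_not_antipodal m omega d1 sharp.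
case: sharp => -[uo oS _ sT] des.
pose S := [seq 2 - 2 * t | t <- dot_values omega].
have sS : size S = m by rewrite size_map.
have uS : uniq S.
  by rewrite map_inj_uniq ?undup_uniq// => s t; lra.
(* Distinct points give s > 0, and s = 4 would mean the excluded scalar product -1; thus f is
   differentiable at every double node. *)
have SI s : s \in S -> 0 < s < 4.
  move=> /mapP[t tT ->]; have [x [y [xo yo xy tE]]] := dot_valuesP _ _ tT.
  have t1 : t != -1 by apply: contraNneq aT => <-.
  have := sqdist_sphere_itv x y (oS x xo) (oS y yo).
  have : sqdist x y != 0 by apply: contra_neq xy; exact: sqdist_eq0.
  rewrite (sqdist_sphere _ _ (oS x xo) (oS y yo)) -tE => t0 /andP[t2 t4].
  rewrite lt_neqAle eq_sym t0 t2 lt_neqAle t4 !andbT /=.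
  by apply/eqP => e; move/eqP: t1; apply; lra.
have S0 : 0 \notin S by apply/negP => /SI; rewrite ltxx.
have dist_mem x y : x \in omega -> y \in omega -> sqdist x y \in 0 :: S.
  move=> xo yo; rewrite inE; have [->|xy] := eqVneq x y.
    by rewrite /sqdist subrr /sqnorm /dotp big1 ?eqxx// => i _; rewrite mxE mul0r.
  apply/orP; right; rewrite (sqdist_sphere _ _ (oS x xo) (oS y yo)).
  by apply/mapP; exists (dotp x y) => //; exact: mem_dot_values.
have [|h [sh h0 hS]] := hermite_interpolation_simple 0 S f (derive1 f).
  by rewrite /= S0.
have n2m : (2 * m - 1).+1 = (2 * size S)%N by rewrite sS; lia.
have maj := hermite_interpolant_not_below _ f 0 4 S h _ n2m fc fn fcc uS SI sh h0 hS.
have hf s : s \in 0 :: S -> h.[s] = f s.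
  by rewrite inE => /orP[/eqP -> //|/hS[]].
have pos s : 0 <= s <= 4 -> s \notin 0 :: S -> 0 < s <= 4 /\ s \notin S.
  rewrite inE negb_or => /andP[s0 s4] /andP[s0' sS'].
  by rewrite s4 sS' lt_neqAle eq_sym s0' s0.
have fh s : 0 <= s <= 4 -> f s <= h.[s].
  move=> sI; have [/hf -> //|sn] := boolP (s \in 0 :: S).
  have [sI' sS'] := pos s sI sn; rewrite leNgt; apply/negP => lt_hf.
  by apply: (maj s sI' sS'); left.
have dI x z : on_sphere x -> z \in omega -> 0 <= sqdist x z <= 4.
  by move=> xS zo; apply: sqdist_sphere_itv => //; exact: oS.
have pot_o y : y \in omega -> potential f omega y = \sum_(z <- omega) h.[sqdist y z].
  move=> yo; rewrite /potential !big_seq; apply: eq_bigr => z zo.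
  by rewrite hf// dist_mem.
have hsum x y : on_sphere x -> on_sphere y ->
    \sum_(z <- omega) h.[sqdist x z] = \sum_(z <- omega) h.[sqdist y z].
  by move=> xS yS; apply: (design_sqdist_sum (2 * m)) => //; rewrite -sS.
split=> [y yo x xS|fsc x xS xmax].
  rewrite (pot_o y yo) -(hsum x y xS (oS y yo)) /potential !big_seq.
  by apply: ler_sum => z zo; apply/fh/dI.
have [y yo] : exists y, y \in omega.
  move: sT; case T : (dot_values omega) => [|t s]; first by move=> m0; move: m1; rewrite -m0.
  by have [|y [_ [yo _ _ _]]] := dot_valuesP omega t; [rewrite T mem_head | exists y].
(* The terms h - f are nonnegative, and their sum at the maximum point [x] is at most 0 because the
   sum of h at [x] equals the potential at [y]. *)
have eq_fh : forall z, z \in omega -> h.[sqdist x z] - f (sqdist x z) = 0.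
  apply: (sum_seq_eq0 _ omega (fun z => h.[sqdist x z] - f (sqdist x z))) => [z zo|].
    by rewrite subr_ge0 fh ?dI.
  apply/eqP; rewrite sumrB subr_eq0 eq_le; apply/andP; split.
    by rewrite (hsum x y xS (oS y yo)) -pot_o// xmax//; exact: oS.
  by rewrite !big_seq; apply: ler_sum => z zo; apply/fh/dI.
(* By strict concavity f and h agree only at nodes. *)
have xnode z : z \in omega -> sqdist x z \in 0 :: S.
  move=> zo; apply/negPn/negP => sn; have [sI sS'] := pos _ (dI x z xS zo) sn.
  apply: (maj _ sI sS'); right; split=> //.
  by move/eqP: (eq_fh z zo); rewrite subr_eq0 => /eqP ->.
apply/negPn/negP => xo.
(* For [x] outside the configuration no distance is 0, so every distance is a root of [P]. As P^2
   has degree 2m, its sum at [y] is the same as at [x], namely 0, whereas the term of [y] itself is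
   P(0)^2 > 0. *)
pose P := \prod_(s <- S) ('X - s%:P).
have sP : (size (P ^+ 2)%R <= (2 * m).+1)%N.
  by rewrite expr2 (leq_trans (size_polyMleq _ _))// !size_prod_XsubC sS; lia.
have sumP : \sum_(z <- omega) (P ^+ 2).[sqdist y z] = 0.
  rewrite (design_sqdist_sum (2 * m) omega (P ^+ 2) y x d1 oS des sP (oS y yo) xS).
  rewrite big_seq big1// => z zo; rewrite horner_exp.
  suff -> : P.[sqdist x z] = 0 by rewrite expr0n.
  apply/eqP; rewrite -[_ == 0]/(root P _) root_prod_XsubC.
  have := xnode z zo; rewrite inE => /orP[/eqP xz|//].
  by move: xo; rewrite (sqdist_eq0 _ _ xz) zo.
have : (P ^+ 2).[sqdist y y] = 0.
  apply: (sum_seq_eq0 _ omega (fun z => (P ^+ 2).[sqdist y z]) _ sumP y yo) => z _.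
  by rewrite horner_exp sqr_ge0.
have -> : sqdist y y = 0.
  by rewrite /sqdist subrr /sqnorm /dotp big1// => i _; rewrite mxE mul0r.
move/eqP; rewrite horner_exp expf_eq0 /= -[_ == 0]/(root P _) root_prod_XsubC.
exact/negP.
Qed.
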